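(* For each $s\in\,]1,2[$ there exists a quasi-copula $Q\in\mathcal{Q}_S$ (that is, a quasi-copula that induces a signed measure on $[0,1]^2$) such that $\dim_{\mathcal{H}}(\mathrm{supp}(Q))=\dim_{\mathcal{B}}(\mathrm{supp}(Q))=s$.
   Context: A (bivariate) quasi-copula is a function $Q\colon[0,1]^2\to[0,1]$ such that: $Q(t,0)=Q(0,t)=0$ and $Q(t,1)=Q(1,t)=t$ for all $t\in[0,1]$; $Q$ is non-decreasing in each variable; and $|Q(u_1,v_1)-Q(u_2,v_2)|\le|u_1-u_2|+|v_1-v_2|$ for all $u_1,v_1,u_2,v_2\in[0,1]$. For a rectangle $R=[u_1,u_2]\times[v_1,v_2]\subseteq[0,1]^2$, the $Q$-volume is $V_Q(R)=Q(u_2,v_2)-Q(u_2,v_1)-Q(u_1,v_2)+Q(u_1,v_1)$. A signed measure on $[0,1]^2$ is an extended real valued, countably additive set function $\mu$ on the Borel $\sigma$-algebra of $[0,1]^2$ with $\mu(\emptyset)=0$ that assumes at most one of the values $\infty$ and $-\infty$. A quasi-copula $Q$ induces the signed measure $\mu$ if $\mu(R)=V_Q(R)$ for every rectangle $R=[u_1,u_2]\times[v_1,v_2]\subseteq[0,1]^2$. $\mathcal{Q}_S$ denotes the set of quasi-copulas that induce a signed measure on $[0,1]^2$. For $Q\in\mathcal{Q}_S$ with induced signed measure $\mu=\mu_1-\mu_2$, where $\mu_1,\mu_2$ are mutually singular positive measures (Hahn decomposition), $\mathrm{supp}(Q)=\mathrm{supp}(\mu)=\mathrm{supp}(\mu_1)\cup\mathrm{supp}(\mu_2)$,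 where the support of a positive measure is the complement in $[0,1]^2$ of the union of all (relatively) open subsets of $[0,1]^2$ of measure zero. $\dim_{\mathcal{H}}$ is the Hausdorff dimension; $\dim_{\mathcal{B}}(E)=-\lim_{\delta\to0}\frac{\ln N_\delta(E)}{\ln\delta}$ is the box-counting dimension, where $N_\delta(E)$ is the smallest number of sets of diameter at most $\delta$ that cover $E$. *)

(* Defs.v *)
From HB Require Import structures.
From mathcomp Require Import all_boot all_order all_algebra.
From mathcomp Require Import all_classical all_reals all_analysis.

Set Implicit Arguments.
Unset Strict Implicit.
Unset Printing Implicit Defensive.

Import Order.TTheory GRing.Theory Num.Theory.
Import numFieldNormedType.Exports.

Local Open Scope classical_set_scope.
Local Open Scope ring_scope.

(* Only the values of Q on the unit square matter; Q is an arbitrary extension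
   of a function [0,1]^2 -> [0,1]. *)
Record quasi_copula (R : realType) (Q : R -> R -> R) : Prop := QuasiCopula {
  qc_range : forall u v, 0 <= u <= 1 -> 0 <= v <= 1 -> 0 <= Q u v <= 1 ;
  qc_zero : forall t, 0 <= t <= 1 -> Q t 0 = 0 /\ Q 0 t = 0 ;
  qc_one : forall t, 0 <= t <= 1 -> Q t 1 = t /\ Q 1 t = t ;
  qc_mono1 : forall u1 u2 v, 0 <= u1 <= 1 -> 0 <= u2 <= 1 -> 0 <= v <= 1 ->
    u1 <= u2 -> Q u1 v <= Q u2 v ;
  qc_mono2 : forall u v1 v2, 0 <= u <= 1 -> 0 <= v1 <= 1 -> 0 <= v2 <= 1 ->
    v1 <= v2 -> Q u v1 <= Q u v2 ;
  qc_lipschitz : forall u1 v1 u2 v2,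
    0 <= u1 <= 1 -> 0 <= v1 <= 1 -> 0 <= u2 <= 1 -> 0 <= v2 <= 1 ->
    `|Q u1 v1 - Q u2 v2| <= `|u1 - u2| + `|v1 - v2|
}.

Definition qvolume (R : realType) (Q : R -> R -> R) (u1 u2 v1 v2 : R) : R :=
  Q u2 v2 - Q u2 v1 - Q u1 v2 + Q u1 v1.

Definition unit_square (R : realType) : set (R * R) :=
  `[0, 1]%classic `*` `[0, 1]%classic.

(* As a type, the unit square carries the topology induced from R * R. *)
Definition square (R : realType) : Type := set_type (@unit_square R).

HB.instance Definition _ (R : realType) :=
  Topological.on (square R).

Fact unit_square0 (R : realType) : (0, 0) \in @unit_square R.
Proof. by rewrite inE; split; rewrite /= in_itv /= lexx ler01. Qed.

HB.instance Definition _ (R : realType) :=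
  isPointed.Build (square R) (exist _ (0, 0) (unit_square0 R)).

Definition square_val (R : realType) (p : square R) : R * R := set_val p.

(* [0,1]^2 with its Borel sigma-algebra. *)
Definition borel_square (R : realType) :=
  g_sigma_algebraType (@open (square R)).

Definition rectangle (R : realType) (u1 u2 v1 v2 : R) : set (borel_square R) :=
  @square_val R @^-1` (`[u1, u2]%classic `*` `[v1, v2]%classic).

Local Open Scope ereal_scope.

(* Unlike the library's charges, a signed measure may take one infinite value. *)
Record signed_measure (d : measure_display) (T : measurableType d)
    (R : realType) (mu : set T -> \bar R) : Prop := SignedMeasure {
  sm_set0 : mu set0 = 0 ;
  sm_sigma_additive : semi_sigma_additive mu ;
  sm_one_infinity : ~ exists A B, [/\ measurable A, measurable B,
    mu A = +oo & mu B = -oo]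
}.

Definition mutually_singular (d : measure_display) (T : measurableType d)
    (R : realType) (mu1 mu2 : {measure set T -> \bar R}) : Prop :=
  exists P, [/\ measurable P, mu1 (~` P) = 0 & mu2 P = 0].

(* When mu is a signed measure, the difference mu1 A - mu2 A is never oo - oo:
   otherwise, with P witnessing singularity, mu P = +oo and mu (~` P) = -oo. *)
Definition jordan_decomposition (d : measure_display) (T : measurableType d)
    (R : realType) (mu : set T -> \bar R)
    (mu1 mu2 : {measure set T -> \bar R}) : Prop :=
  mutually_singular mu1 mu2 /\
  forall A, measurable A -> mu A = mu1 A - mu2 A.

Definition induces (R : realType) (Q : R -> R -> R)
    (mu : set (borel_square R) -> \bar R) : Prop :=
  forall u1 u2 v1 v2 : R,
    (0 <= u1)%R -> (u1 <= u2)%R -> (u2 <= 1)%R ->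
    (0 <= v1)%R -> (v1 <= v2)%R -> (v2 <= 1)%R ->
    mu (rectangle u1 u2 v1 v2) = (qvolume Q u1 u2 v1 v2)%:E.

Definition induces_signed_measure (R : realType) (Q : R -> R -> R) : Prop :=
  exists mu : set (borel_square R) -> \bar R,
    signed_measure mu /\ induces Q mu.

Definition measure_support (R : realType)
    (m : {measure set (borel_square R) -> \bar R}) : set (square R) :=
  ~` \bigcup_(U in [set U : set (square R) | open U /\ m U = 0]) U.

(* S = supp(Q).  The measure induced by Q is unique, and so is its Jordan
   decomposition, hence at most one set S satisfies this relation. *)
Definition is_support (R : realType) (Q : R -> R -> R) (S : set (R * R)) : Prop :=
  exists (mu : set (borel_square R) -> \bar R)
         (mu1 mu2 : {measure set (borel_square R) -> \bar R}),
    [/\ signed_measure mu, induces Q mu, jordan_decomposition mu mu1 mu2 &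
        S = @square_val R @` (measure_support mu1 `|` measure_support mu2)].

(* The library's norm on R * R is the max norm. *)
Definition eucl_dist (R : realType) (p q : R * R) : R :=
  Num.sqrt ((p.1 - q.1) ^+ 2 + (p.2 - q.2) ^+ 2)%R.

(* The added 0 only serves to make the diameter of the empty set 0. *)
Definition diam (R : realType) (A : set (R * R)) : \bar R :=
  ereal_sup ([set 0] `|` [set (eucl_dist p q)%:E | p in A & q in A]).

(* |A|^t, with the convention that the empty set counts 0, even for t = 0. *)
Definition diam_pow (R : realType) (t : R) (A : set (R * R)) : \bar R :=
  if A == set0 then 0 else poweR (diam A) t.

Definition hausdorff_premeasure (R : realType) (t delta : R)
    (E : set (R * R)) : \bar R :=
  ereal_inf [set \sum_(0 <= i <oo) diam_pow t (U i) | U in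
    [set U : nat -> set (R * R) |
      E `<=` \bigcup_i U i /\ forall i, diam (U i) <= delta%:E]].

(* The limit as delta -> 0+ is a supremum, as the premeasure is nonincreasing
   in delta. *)
Definition hausdorff_measure (R : realType) (t : R) (E : set (R * R)) : \bar R :=
  ereal_sup [set hausdorff_premeasure t delta E | delta in
    [set delta : R | (0 < delta)%R]].

Definition hausdorff_dim (R : realType) (E : set (R * R)) : \bar R :=
  ereal_inf [set t%:E | t in
    [set t : R | (0 <= t)%R /\ hausdorff_measure t E = 0]].

(* An infimum of naturals is attained; it is +oo when there is no finite cover. *)
Definition covering_number (R : realType) (delta : R) (E : set (R * R)) : \bar R :=
  ereal_inf [set (n%:R : R)%:E | n in
    [set n : nat | exists U : 'I_n -> set (R * R),
      E `<=` \bigcup_i U i /\ forall i, diam (U i) <= delta%:E]].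

(* The limit defining the box-counting dimension exists and equals s. *)
Definition has_box_dim (R : realType) (E : set (R * R)) (s : R) : Prop :=
  - (lne (covering_number delta E) * ((ln delta)^-1)%:E)
    @[delta --> 0%R^'+] --> s%:E.

(* Main.v *)
Require Import Defs.
From HB Require Import structures.
From mathcomp Require Import all_boot all_order all_algebra.
From mathcomp Require Import all_classical all_reals all_analysis.
From mathcomp Require Import measurable_realfun ring lra zify.
Import Order.TTheory GRing.Theory Num.Theory.
Import numFieldNormedType.Exports.

Set Implicit Arguments.
Unset Strict Implicit.
Unset Printing Implicit Defensive.

Local Open Scope classical_set_scope.
Local Open Scope ring_scope.

(** The quasi-copula constructed here is a copula, the distribution function of
a random point (x, y) of the square. Let x and w be independent and uniform in
[0, 1[, let c be the map that reads the binary digits of w as the digits of a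
point of the Cantor set of ratio rho, and let y = x + c w modulo 1.

Both marginals are uniform for every monotone c into [0, 1]: given w, the
point y is the image of x under a rotation of the circle
[lebesgue_measure_rotation], so it is uniform as well [graph_mu_marginal2]. A
measure mu on the square with uniform marginals always gives a quasi-copula
Q u v = mu ([0, u] x [0, v]) that induces it
[copula_quasi_copula, copula_induces]; being positive, the measure is its own
Jordan decomposition, and the support of Q is the support of mu.

In the coordinates (x, y - x) the support is a segment times a Cantor set, so
its dimension should be 1 + ln 2 / ln (1 / rho). This number is s exactly when
rho ^ (s - 1) = 1 / 2, and s < 2 says that rho < 1 / 2, so that the Cantor set
has gaps. Two estimates with the exponent s make this precise.
- A set of diameter r has mass at most C * r ^ s [mass_of_small_set]. If (x, y)
  lies within r of (a, b), then x lies in an interval of length 2 * r, and c w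
  lies within 2 * r of b - a or of b - a + 1. The gaps of the Cantor set make
  the inverse of c Hoelder continuous of exponent s - 1
  [cantor_map_inverse_holder], which confines w to two intervals of length
  O (r ^ (s - 1)).
- At scale rho ^ n the support is covered by O (rho ^ (- n * s)) boxes
  [fractal_set_cover, card_cover_index]: there are 2 ^ n = rho ^ (- n * (s - 1))
  pieces of the Cantor set and about rho ^ (- n) columns.
The first estimate bounds both dimensions from below, since the masses of the
members of a cover add up to at least 1. The second one bounds them from above.
This deduction is [ahlfors_hausdorff_dim] and [ahlfors_box_dim]. *)

(** * Copulas of measures with uniform marginals *)

Lemma closed_measurable_square (R : realType) (C : set (R * R)) :
  closed C -> measurable (@square_val R @^-1` C : set (borel_square R)).
Proof.
move=> cC; rewrite -[X in measurable X]setCK; apply: measurableC.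
by apply: sub_sigma_algebra; exists (~` C) => //; rewrite openC.
Qed.

Lemma closed_box (R : realType) (a b c d : R) :
  closed (`[a, b]%classic `*` `[c, d]%classic : set (R * R)).
Proof.
have -> : `[a, b]%classic `*` `[c, d]%classic =
    (@fst R R @^-1` `[a, b]%classic) `&` (@snd R R @^-1` `[c, d]%classic).
  by apply/seteqP; split.
by apply: closedI; apply: closed_comp; do ?exact: itv_closed;
  move=> x _; [exact: cvg_fst|exact: cvg_snd].
Qed.

Lemma measurable_rectangle (R : realType) (u1 u2 v1 v2 : R) :
  measurable (rectangle u1 u2 v1 v2).
Proof. by apply: closed_measurable_square; exact: closed_box. Qed.

(** A measure with uniform marginals gives no mass to horizontal and vertical
segments, so closed rectangles that share a side can be glued as if they were
disjoint. Every property of the distribution function below follows from this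
gluing and from the monotonicity of the measure. *)
Section copula_of_measure.
Variables (R : realType) (m : {measure set (borel_square R) -> \bar R}).
Hypothesis marginal1 : forall a b : R, 0 <= a -> a <= b -> b <= 1 ->
  m (rectangle a b 0 1) = (b - a)%:E.
Hypothesis marginal2 : forall a b : R, 0 <= a -> a <= b -> b <= 1 ->
  m (rectangle 0 1 a b) = (b - a)%:E.

Definition copula_of_measure (u v : R) : R := fine (m (rectangle 0 u 0 v)).

Local Notation Q := copula_of_measure.

Let vol u1 u2 v1 v2 : R := fine (m (rectangle u1 u2 v1 v2)).

Lemma le_measure_rectangle (u1 u2 v1 v2 u1' u2' v1' v2' : R) :
  u1' <= u1 -> u2 <= u2' -> v1' <= v1 -> v2 <= v2' ->
  (m (rectangle u1 u2 v1 v2) <= m (rectangle u1' u2' v1' v2'))%E.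
Proof.
move=> h1 h2 h3 h4; apply: le_measure; rewrite ?inE; do ?exact: measurable_rectangle.
move=> p [] /=; rewrite !in_itv /= => /andP[a b] /andP[c d].
by split; rewrite /= in_itv /=; lra.
Qed.

Lemma measure_square : m setT = 1%:E.
Proof.
rewrite -[1]subr0 -marginal1 ?lexx ?ler01//; congr (m _).
by apply/seteqP; split => // -[p hp] _; exact: (set_mem hp).
Qed.

Lemma measure_fin A : measurable A -> m A \is a fin_num.
Proof.
move=> mA; rewrite ge0_fin_numE//; apply: (@le_lt_trans _ _ (m setT)).
  by apply: le_measure; rewrite ?inE//; exact: measurableT.
by rewrite measure_square ltry.
Qed.

Lemma measure_glue A B : measurable A -> measurable B ->
  m (A `&` B) = 0%E -> m (A `|` B) = (m A + m B)%E.
Proof.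
move=> mA mB AB0; rewrite measureUfinr ?AB0 ?sube0//.
by rewrite ltey_eq measure_fin.
Qed.

Let volE u1 u2 v1 v2 : (vol u1 u2 v1 v2)%:E = m (rectangle u1 u2 v1 v2).
Proof. by rewrite fineK// measure_fin//; exact: measurable_rectangle. Qed.

Let vol_le (u1 u2 v1 v2 u1' u2' v1' v2' : R) :
  u1' <= u1 -> u2 <= u2' -> v1' <= v1 -> v2 <= v2' ->
  vol u1 u2 v1 v2 <= vol u1' u2' v1' v2'.
Proof. by move=> *; rewrite -lee_fin !volE le_measure_rectangle. Qed.

Let vol1 a b : 0 <= a -> a <= b -> b <= 1 -> vol a b 0 1 = b - a.
Proof. by move=> *; rewrite /vol marginal1. Qed.

Let vol2 a b : 0 <= a -> a <= b -> b <= 1 -> vol 0 1 a b = b - a.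
Proof. by move=> *; rewrite /vol marginal2. Qed.

Let vol_cut1 a b c v1 v2 : 0 <= a -> a <= b -> b <= c -> c <= 1 ->
  0 <= v1 -> v2 <= 1 -> vol a c v1 v2 = vol a b v1 v2 + vol b c v1 v2.
Proof.
move=> a0 ab bc c1 v10 v21; apply/EFin_inj; rewrite EFinD !volE -measure_glue.
- congr (m _); apply/seteqP; split=> p.
    move=> [] /=; rewrite !in_itv /= => /andP[h1 h2] h3.
    by have [le|/ltW le] := leP (square_val p).1 b; [left|right]; split => //=;
      rewrite in_itv /= le ?h1 ?h2.
  by case=> -[]; rewrite /= !in_itv /= => /andP[h1 h2] h3; split => //=;
    rewrite in_itv /=; lra.
- exact: measurable_rectangle.
- exact: measurable_rectangle.
apply/eqP; rewrite -measure_le0; apply: (@le_trans _ _ (m (rectangle b b 0 1))).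
  apply: le_measure; rewrite ?inE; do ?exact: measurable_rectangle.
    by apply: measurableI; exact: measurable_rectangle.
  move=> p [] [] /=; rewrite !in_itv /= => h1 h2 [] /=.
  by rewrite !in_itv/= => h3 _; split => /=; rewrite in_itv /=; lra.
by rewrite marginal1 ?subrr//; lra.
Qed.

Let vol_cut2 u1 u2 a b c : 0 <= a -> a <= b -> b <= c -> c <= 1 ->
  0 <= u1 -> u2 <= 1 -> vol u1 u2 a c = vol u1 u2 a b + vol u1 u2 b c.
Proof.
move=> a0 ab bc c1 v10 v21; apply/EFin_inj; rewrite EFinD !volE -measure_glue.
- congr (m _); apply/seteqP; split=> p.
    move=> [] /= h3; rewrite !in_itv /= => /andP[h1 h2].
    by have [le|/ltW le] := leP (square_val p).2 b; [left|right]; split => //=;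
      rewrite in_itv /= le ?h1 ?h2.
  by case=> -[]; rewrite /= !in_itv /= => h3 /andP[h1 h2]; split => //=;
    rewrite in_itv /=; lra.
- exact: measurable_rectangle.
- exact: measurable_rectangle.
apply/eqP; rewrite -measure_le0; apply: (@le_trans _ _ (m (rectangle 0 1 b b))).
  apply: le_measure; rewrite ?inE; do ?exact: measurable_rectangle.
    by apply: measurableI; exact: measurable_rectangle.
  move=> p [] [] /=; rewrite !in_itv /= => h1 h2 [] /=.
  by rewrite !in_itv/= => h3 h4; split => /=; rewrite in_itv /=; lra.
by rewrite marginal2 ?subrr//; lra.
Qed.

Let vol_ge0 u1 u2 v1 v2 : 0 <= vol u1 u2 v1 v2.
Proof. by rewrite -lee_fin volE. Qed.

Lemma copula_induces : induces Q m.
Proof.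
move=> u1 u2 v1 v2 u10 u12 u21 v10 v12 v21; rewrite -volE; congr (_%:E).
rewrite /qvolume /Q -!/(vol _ _ _ _) (vol_cut2 (a := 0) (b := v1) (c := v2))//; [|lra..].
rewrite (vol_cut2 (u2 := u1) (a := 0) (b := v1) (c := v2))//; [|lra..].
rewrite (vol_cut1 (a := 0) (b := u1) (c := u2) (v1 := v1))//; by [ring|lra].
Qed.

Let dist1 u1 u2 v : 0 <= u1 <= 1 -> 0 <= u2 <= 1 -> 0 <= v <= 1 ->
  `|Q u1 v - Q u2 v| <= `|u1 - u2|.
Proof.
move=> h1 h2 h3; wlog le : u1 u2 h1 h2 / u1 <= u2.
  by move=> H; have [?|/ltW ?] := leP u1 u2; last rewrite distrC (distrC u1); exact: H.
rewrite distrC (distrC u1) (ger0_norm (x := u2 - u1)) ?subr_ge0//.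
rewrite /Q -!/(vol _ _ _ _) (vol_cut1 (b := u1))//; [|lra..].
rewrite addrC addKr ger0_norm// -vol1//; [|lra..].
by apply: vol_le => //; lra.
Qed.

Let dist2 u v1 v2 : 0 <= u <= 1 -> 0 <= v1 <= 1 -> 0 <= v2 <= 1 ->
  `|Q u v1 - Q u v2| <= `|v1 - v2|.
Proof.
move=> h3 h1 h2; wlog le : v1 v2 h1 h2 / v1 <= v2.
  by move=> H; have [?|/ltW ?] := leP v1 v2; last rewrite distrC (distrC v1); exact: H.
rewrite distrC (distrC v1) (ger0_norm (x := v2 - v1)) ?subr_ge0//.
rewrite /Q -!/(vol _ _ _ _) (vol_cut2 (b := v1))//; [|lra..].
rewrite addrC addKr ger0_norm// -vol2//; [|lra..].
by apply: vol_le => //; lra.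
Qed.

Lemma copula_quasi_copula : quasi_copula Q.
Proof.
have Q0 t : 0 <= t <= 1 -> Q t 0 = 0 /\ Q 0 t = 0.
  move=> h; split; apply/eqP; rewrite eq_le vol_ge0 andbT.
    by rewrite -[leRHS](subrr (0 : R)) -vol2//; apply: vol_le; lra.
  by rewrite -[leRHS](subrr (0 : R)) -vol1//; apply: vol_le; lra.
split => //.
- move=> u v hu hv; rewrite vol_ge0/= -[leRHS]subr0 -vol1//.
  by apply: vol_le; lra.
- move=> t h; split.
    by rewrite /Q -/(vol _ _ _ _) vol1 ?subr0//; lra.
  by rewrite /Q -/(vol _ _ _ _) vol2 ?subr0//; lra.
- by move=> *; apply: vol_le.
- by move=> *; apply: vol_le.
move=> u1 v1 u2 v2 *; rewrite -(subrKA (Q u2 v1)).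
by apply: (le_trans (ler_normD _ _)); apply: lerD; [exact: dist1|exact: dist2].
Qed.

Lemma measure_signed_measure : signed_measure m.
Proof.
split; [exact: measure0|exact: measure_semi_sigma_additive|].
move=> [A [B [_ _ _ mB]]]; suff : (0 <= -oo :> \bar R)%E by [].
by rewrite -mB; exact: measure_ge0.
Qed.

Lemma copula_induces_signed_measure : induces_signed_measure Q.
Proof. exists m; split; [exact: measure_signed_measure|exact: copula_induces]. Qed.

(** A positive measure is its own Jordan decomposition, with zero as its negative
part; the support of the zero measure is empty. *)
Lemma copula_is_support : is_support Q (@square_val R @` measure_support m).
Proof.
exists m, m, mzero; split.
- exact: measure_signed_measure.
- exact: copula_induces.
- split; last by move=> A _; rewrite /= /mzero sube0.
  by exists setT; split; [exact: measurableT|rewrite setCT measure0|].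
congr image; rewrite [X in _ `|` X](_ : _ = set0) ?setU0//.
rewrite /measure_support -subset0 => x; apply.
by exists setT => //; split; [exact: openT|].
Qed.

End copula_of_measure.

(** * Hausdorff and box dimension from a mass bound and a covering bound *)

Lemma coord_le_eucl_dist (R : realType) (p q : R * R) :
  `|p.1 - q.1| <= eucl_dist p q /\ `|p.2 - q.2| <= eucl_dist p q.
Proof.
rewrite /eucl_dist -!sqrtr_sqr.
by split; apply: ler_wsqrtr; rewrite ?lerDl ?lerDr sqr_ge0.
Qed.

Lemma eucl_dist_le_coord (R : realType) (p q : R * R) :
  eucl_dist p q <= `|p.1 - q.1| + `|p.2 - q.2|.
Proof.
rewrite /eucl_dist -[leRHS]ger0_norm ?addr_ge0// -sqrtr_sqr; apply: ler_wsqrtr.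
rewrite [leRHS]sqrrD !real_normK ?num_real// addrAC lerDl.
by rewrite mulrn_wge0// mulr_ge0.
Qed.

Section diameter.
Variable R : realType.
Implicit Types (A B : set (R * R)) (t r : R).

Lemma diam_ge0 A : (0 <= diam A)%E.
Proof. by apply: ereal_sup_ubound; left. Qed.

Lemma eucl_dist_le_diam A p q : A p -> A q -> ((eucl_dist p q)%:E <= diam A)%E.
Proof. by move=> Ap Aq; apply: ereal_sup_ubound; right; exists p => //; exists q. Qed.

Lemma diam_le A r : 0 <= r ->
  (forall p q, A p -> A q -> eucl_dist p q <= r) -> (diam A <= r%:E)%E.
Proof.
move=> r0 h; apply: ge_ereal_sup => _ [->|[p Ap [q Aq <-]]]; rewrite lee_fin//.
exact: h.
Qed.

Lemma diam_finP A r : (diam A <= r%:E)%E ->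
  exists2 d, diam A = d%:E & 0 <= d <= r.
Proof.
move=> h; have := diam_ge0 A; move: h; case: (diam A) => [d| |] //.
by rewrite !lee_fin => h1 h2; exists d; rewrite ?h2.
Qed.

Lemma diam_pow_ge0 t A : (0 <= diam_pow t A)%E.
Proof. by rewrite /diam_pow; case: ifP => // _; exact: poweR_ge0. Qed.

Lemma diam_pow_set0 t : diam_pow t (set0 : set (R * R)) = 0%E.
Proof. by rewrite /diam_pow eqxx. Qed.

Lemma diam_pow_le t r A : 0 <= t -> (diam A <= r%:E)%E ->
  (diam_pow t A <= (r `^ t)%:E)%E.
Proof.
move=> t0 h; rewrite /diam_pow; case: ifP => _; first by rewrite lee_fin powR_ge0.
have [d -> /andP[h1 h2]] := diam_finP h; rewrite lee_fin.
by apply: ge0_ler_powR; rewrite ?nnegrE//; exact: le_trans h2.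
Qed.

(** Below diameter 1, lowering the exponent raises the power. The mass bound with
exponent s therefore also holds with every smaller exponent. *)
Lemma diam_pow_antitone t1 t2 A : 0 < t2 -> t1 <= t2 ->
  (diam A <= 1%:E)%E -> (diam_pow t2 A <= diam_pow t1 A)%E.
Proof.
move=> t0 h12 h; rewrite /diam_pow; case: ifP => _ //.
have [d -> /andP[h2 h1]] := diam_finP h; rewrite lee_fin.
move: h2; rewrite le_eqVlt => /predU1P[<-|h2].
  by rewrite (powR0 (lt0r_neq0 t0)) powR_ge0.
by apply: ger_powR; rewrite ?h2 ?h1.
Qed.

(** Hausdorff measures use sequences of sets, box counting uses finite families;
padding with the empty set, of diameter power 0, passes from the latter to the
former at no cost. *)
Definition extend_cover n (U : 'I_n -> set (R * R)) (i : nat) : set (R * R) :=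
  if insub i is Some j then U j else set0.

Lemma extend_coverE n (U : 'I_n -> set (R * R)) (i : 'I_n) :
  extend_cover U i = U i.
Proof. by rewrite /extend_cover valK. Qed.

Lemma extend_cover_bigcup n (U : 'I_n -> set (R * R)) :
  \bigcup_i U i `<=` \bigcup_i extend_cover U i.
Proof.
move=> p [i _ Uip]; exists (val i) => //.
by rewrite extend_coverE.
Qed.

Lemma extend_cover_diam n (U : 'I_n -> set (R * R)) r : 0 <= r ->
  (forall i, (diam (U i) <= r%:E)%E) ->
  forall i, (diam (extend_cover U i) <= r%:E)%E.
Proof.
move=> r0 h i; rewrite /extend_cover; case: insub => [j|]; first exact: h.
exact: diam_le.
Qed.

Lemma extend_cover_sum n (U : 'I_n -> set (R * R)) t r : 0 <= t ->
  (forall i, (diam (U i) <= r%:E)%E) ->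
  (\sum_(0 <= i <oo) diam_pow t (extend_cover U i) <= (n%:R * r `^ t)%:E)%E.
Proof.
move=> t0 h; rewrite (nneseries_split 0 n); last by move=> *; exact: diam_pow_ge0.
rewrite eseries0; last first.
  move=> i; rewrite add0n => ni _.
  by rewrite /extend_cover insubF ?diam_pow_set0// ltnNge ni.
rewrite adde0 add0n big_mkord.
apply: (@le_trans _ _ (\sum_(i < n) (r `^ t)%:E)%E).
  apply: lee_sum => i _; rewrite extend_coverE.
  exact: diam_pow_le.
by rewrite sumEFin sumr_const card_ord mulr_natl.
Qed.

End diameter.

(** The two hypotheses [mass_bound] and [cover_bound] isolate what a computation
of dimensions uses of S: a measure of exponent s carried by S enters only through
the lower bound that it gives for covers. *)
Section ahlfors_dimension.
Variables (R : realType) (S : set (R * R)) (s C K : R).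
Hypotheses (s_gt0 : 0 < s) (C_gt0 : 0 < C) (K_gt0 : 0 < K).
Hypothesis mass_bound : forall U : nat -> set (R * R),
  S `<=` \bigcup_i U i -> (forall i, (diam (U i) <= 1%:E)%E) ->
  (1%:E <= C%:E * \sum_(0 <= i <oo) diam_pow s (U i))%E.
Hypothesis cover_bound : forall delta : R, 0 < delta <= 1 ->
  exists (n : nat) (U : 'I_n -> set (R * R)),
    [/\ S `<=` \bigcup_i U i, forall i, (diam (U i) <= delta%:E)%E &
        n%:R <= K * delta `^ (- s)].

Lemma hausdorff_measure_eq0 t : s < t -> hausdorff_measure t S = 0%E.
Proof.
move=> st; have t0 : 0 <= t by rewrite ltW// (lt_trans s_gt0).
apply/eqP; rewrite eq_le; apply/andP; split; last first.
  apply: (@le_trans _ _ (hausdorff_premeasure t 1 S)); last first.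
    by apply: ereal_sup_ubound; exists 1 => //=.
  apply: le_ereal_inf_tmp => _ [U _ <-]; apply: nneseries_ge0 => *.
  exact: diam_pow_ge0.
apply: ge_ereal_sup => _ [delta /= delta0 <-].
apply/lee_addgt0Pr => e e0; rewrite add0e.
have ts : 0 < t - s by rewrite subr_gt0.
(* at scale x at most K * x ^ (- s) sets are needed, for a total of at most
   K * x ^ (t - s), which is at most e when x <= (e / K) ^ (1 / (t - s)) *)
pose y := (e / K) `^ (t - s)^-1.
have y0 : 0 < y by rewrite powR_gt0 ?divr_gt0.
pose x := Num.min (Num.min delta 1) y.
have x0 : 0 < x by rewrite !lt_min delta0 ltr01 y0.
have xd : x <= delta by rewrite !ge_min lexx.
have x1 : x <= 1 by rewrite !ge_min lexx !orbT.
have xy : x <= y by rewrite !ge_min lexx !orbT.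
have [|n [U [SU dU nK]]] := @cover_bound x; first by rewrite x0.
apply: (@le_trans _ _ (\sum_(0 <= i <oo) diam_pow t (extend_cover U i))%E).
  apply: ereal_inf_lbound; exists (extend_cover U) => //; split.
    exact: subset_trans SU (@extend_cover_bigcup _ _ U).
  by apply: extend_cover_diam => [|i]; [exact: ltW|rewrite (le_trans (dU i)) ?lee_fin].
apply: (le_trans (extend_cover_sum t0 dU)); rewrite lee_fin.
apply: (@le_trans _ _ (K * x `^ (- s) * x `^ t)).
  by rewrite ler_wpM2r// powR_ge0.
rewrite -mulrA -powRD; last by rewrite (gt_eqF x0) implybT.
rewrite addrC -[leRHS](divfK (lt0r_neq0 K_gt0)) mulrC ler_wpM2r//; first exact: ltW.
rewrite -[leRHS]powRr1; last by rewrite divr_ge0// ltW.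
rewrite -(mulVf (lt0r_neq0 ts)) powRrM -/y.
by apply: ge0_ler_powR; rewrite ?nnegrE// ltW.
Qed.

(** If t < s, a cover whose sum of powers of exponent t is less than 1 / C has a
smaller sum with exponent s, against the mass bound. *)
Lemma le_of_hausdorff_measure_eq0 t : hausdorff_measure t S = 0%E -> s <= t.
Proof.
move=> H0; rewrite leNgt; apply/negP => ts.
have : (hausdorff_premeasure t 1 S < (C^-1)%:E)%E.
  apply: (@le_lt_trans _ _ 0%E); last by rewrite lte_fin invr_gt0.
  by rewrite -H0; apply: ereal_sup_ubound; exists 1 => //=.
move=> /ereal_inf_lt[_ [U [SU dU] <-]]; apply/negP; rewrite -leNgt.
rewrite -(@lee_pmul2l _ C%:E) ?lte_fin// -EFinM divff ?lt0r_neq0//.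
apply: (le_trans (mass_bound SU dU)); apply: lee_pmul => //.
- by rewrite lee_fin ltW.
- by apply: nneseries_ge0 => *; exact: diam_pow_ge0.
apply: lee_nneseries => [*|i _]; first exact: diam_pow_ge0.
by apply: diam_pow_antitone => //; exact: ltW.
Qed.

Lemma ahlfors_hausdorff_dim : hausdorff_dim S = s%:E.
Proof.
apply/eqP; rewrite eq_le; apply/andP; split.
  apply/lee_addgt0Pr => e e0; rewrite -EFinD; apply: ereal_inf_lbound.
  exists (s + e) => //=; split; first by rewrite addr_ge0// ltW.
  by apply: hausdorff_measure_eq0; rewrite ltrDl.
apply: le_ereal_inf_tmp => _ [t [t0 H0] <-]; rewrite lee_fin.
exact: le_of_hausdorff_measure_eq0.
Qed.

Lemma covering_number_bounds delta : 0 < delta <= 1 ->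
  exists2 r, covering_number delta S = r%:E &
    C^-1 * delta `^ (- s) <= r <= K * delta `^ (- s).
Proof.
move=> /[dup] d1 /andP[d0 dle1]; have [n [U [SU dU nK]]] := cover_bound d1.
have ub : (covering_number delta S <= (K * delta `^ (- s))%:E)%E.
  apply: (@le_trans _ _ (n%:R)%:E); last by rewrite lee_fin.
  by apply: ereal_inf_lbound; exists n => //; exists U.
have lb : ((C^-1 * delta `^ (- s))%:E <= covering_number delta S)%E.
  apply: le_ereal_inf_tmp => _ [k [V [SV dV]] <-]; rewrite lee_fin.
  have : (1%:E <= C%:E * \sum_(0 <= i <oo) diam_pow s (extend_cover V i))%E.
    apply: mass_bound; first exact: subset_trans SV (@extend_cover_bigcup _ _ V).
    apply: extend_cover_diam => // i.
    by apply: (le_trans (dV i)); rewrite lee_fin.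
  move=> /le_trans h; have := h (C * (k%:R * delta `^ s))%:E.
  rewrite EFinM lee_pmul2l ?lte_fin// => /(_ (extend_cover_sum (ltW s_gt0) dV)).
  rewrite -EFinM lee_fin => {}h.
  by rewrite powRN -invfM -div1r ler_pdivrMr ?mulr_gt0 ?powR_gt0// mulrCA.
have fin : covering_number delta S \is a fin_num.
  by rewrite fin_numElt (lt_le_trans _ lb) ?ltNyr// (le_lt_trans ub) ?ltry.
exists (fine (covering_number delta S)); first by rewrite fineK.
by move: lb ub; rewrite -(fineK fin) !lee_fin => -> ->.
Qed.

(** The covering number lies between two multiples of delta ^ (- s). Its logarithm
is then - s * ln delta up to a bounded error, which the division by ln delta
makes vanish. *)
Lemma ahlfors_box_dim : has_box_dim S s.
Proof.
pose M : R := Num.max `|ln C^-1| `|ln K|.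
have M0 : 0 <= M by rewrite le_max normr_ge0.
have key (delta : R) : 0 < delta < 1 ->
    exists2 r, (- (lne (covering_number delta S) * ((ln delta)^-1)%:E))%E = r%:E &
      `|s - r| <= M / - ln delta.
  move=> /andP[d0 d1].
  have [|r -> /andP[lb ub]] := @covering_number_bounds delta; first by rewrite d0 ltW.
  have p0 : 0 < delta `^ (- s) by rewrite powR_gt0.
  have r0 : 0 < r by apply: lt_le_trans lb; rewrite mulr_gt0 ?invr_gt0.
  have ln0 : ln delta < 0 by rewrite ln_lt0 // d0.
  exists (- (ln r / ln delta)); first by rewrite /= leNgt r0.
  have lnp : ln (delta `^ (- s)) = - s * ln delta by rewrite ln_powR.
  rewrite opprK (_ : s + _ = (s * ln delta + ln r) / ln delta); last first.
    by field; rewrite lt_eqF.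
  rewrite normrM normfV (ltr0_norm ln0) ler_wpM2r ?invr_ge0 ?oppr_ge0 ?(ltW ln0)//.
  move: lb ub.
  rewrite -ler_ln ?posrE ?mulr_gt0 ?invr_gt0// lnM ?posrE ?invr_gt0// lnp => lb.
  rewrite -ler_ln ?posrE ?mulr_gt0// lnM ?posrE// lnp => ub.
  have h1 : `|ln C^-1| <= M by rewrite le_max lexx.
  have h2 : `|ln K| <= M by rewrite le_max lexx orbT.
  move: h1 h2; rewrite !ler_norml => /andP[a b] /andP[c d]; lra.
apply/fine_cvgP; split.
  near=> delta; have [|r -> _//] := key delta.
  by apply/andP; split; near: delta; [exact: nbhs_right_gt|exact: nbhs_right_lt].
apply/cvgrPdist_le => e e0; near=> delta.
have d0 : 0 < delta by near: delta; exact: nbhs_right_gt.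
have dlt : delta < expR (- (M / e)) by near: delta; apply: nbhs_right_lt; exact: expR_gt0.
have [|r /= -> h] := key delta.
  by rewrite d0/=; near: delta; exact: nbhs_right_lt.
apply: (le_trans h) => /=.
have : ln delta < - (M / e) by rewrite -[ltRHS]expRK ltr_ln ?posrE ?expR_gt0.
rewrite ltrNr => lnl; rewrite ler_pdivrMr; last first.
  by apply: le_lt_trans lnl; rewrite divr_ge0// ltW.
by rewrite mulrC -ler_pdivrMr// ltW.
Unshelve. all: by end_near. Qed.

End ahlfors_dimension.

(** * The Cantor map *)

Lemma exists_expr_le (R : realType) (x e : R) : 0 <= x < 1 -> 0 < e ->
  exists n, x ^+ n <= e.
Proof.
move=> /andP[x0 x1] e0; have : `|x| < 1 by rewrite ger0_norm.
move=> /cvg_expr/cvgrPdist_le h.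
have [N _ /(_ N (leqnn N))] := h _ e0.
by rewrite sub0r normrN ger0_norm ?exprn_ge0// => xN; exists N.
Qed.

Section dyadic.
Variable R : realType.
Implicit Types t : R.

Definition dyadic n t : int := Num.floor (2 ^+ n * t).

Lemma dyadicP n t : (dyadic n t)%:~R <= 2 ^+ n * t < (dyadic n t)%:~R + 1.
Proof. by have := floor_itv (2 ^+ n * t); rewrite intrD. Qed.

Lemma dyadic_le n t t' : t <= t' -> dyadic n t <= dyadic n t'.
Proof. by move=> h; apply: le_floor; rewrite ler_pM2l// exprn_gt0. Qed.

Lemma dyadic_eqP n t (k : int) : k%:~R <= 2 ^+ n * t < k%:~R + 1 -> dyadic n t = k.
Proof. by move=> h; apply: floor_def; rewrite intrD. Qed.

Lemma dyadicS n t : 2 * dyadic n t <= dyadic n.+1 t <= 2 * dyadic n t + 1.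
Proof.
have := dyadicP n t; have := dyadicP n.+1 t; rewrite exprS -mulrA.
set x := 2 ^+ n * t; set a := dyadic n t; set b := dyadic n.+1 t => h1 h2.
have hb : (2 * a)%:~R < b%:~R + 1 :> R by rewrite intrM; lra.
have hc : b%:~R < (2 * a + 2)%:~R :> R by rewrite intrD intrM; lra.
have {}hb : (2 * a)%:~R < (b + 1)%:~R :> R by rewrite intrD.
move: hb hc; rewrite !ltr_int; lia.
Qed.

Lemma dyadic_eq_lower n m t t' : (m <= n)%N -> t <= t' ->
  dyadic n t = dyadic n t' -> dyadic m t = dyadic m t'.
Proof.
move=> + le; elim: n => [|n IH]; first by rewrite leqn0 => /eqP ->.
rewrite leq_eqVlt => /predU1P[->//|/IH {}IH] h; apply: IH.
have := dyadicS n t; have := dyadicS n t'; have := dyadic_le n le; lia.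
Qed.

Lemma dyadic_dist n t t' : t <= t' -> dyadic n t = dyadic n t' ->
  t' - t <= 2^-1 ^+ n.
Proof.
move=> le E; have := dyadicP n t; have := dyadicP n t'; rewrite E => h1 h2.
by rewrite exprVn -[leRHS]mul1r ler_pdivlMr ?exprn_gt0//; lra.
Qed.

Lemma dyadic_separates t t' : t < t' -> exists n, dyadic n t != dyadic n t'.
Proof.
move=> lt; have d0 : 0 < (t' - t) / 2 by lra.
have [|n hn] := @exists_expr_le R 2^-1 _ _ d0; first by lra.
exists n; apply/negP => /eqP/(dyadic_dist (ltW lt)); lra.
Qed.

End dyadic.

Section cantor_map.
Variables (R : realType) (rho : R).
Hypothesis rho_bound : 0 < rho < 2^-1.
Implicit Types t : R.

Let rho_gt0 : 0 < rho. Proof. by case/andP: rho_bound. Qed.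

Let rhoX_gt0 n : 0 < rho ^+ n. Proof. by rewrite exprn_gt0. Qed.

Let rhoX_le n m : (n <= m)%N -> rho ^+ m <= rho ^+ n.
Proof. by apply: ler_wiXn2l; move: rho_bound; lra. Qed.

(** The binary digits of the fractional part of t. *)
Definition cantor_digit k t : R := (dyadic k.+1 t - 2 * dyadic k t)%:~R.

(** The integral part of t is kept as it is, which makes the map below monotone on
the whole line and not only on [0, 1[. *)
Definition cantor_partial n t : R :=
  (dyadic 0 t)%:~R + \sum_(k < n) (1 - rho) * rho ^+ k * cantor_digit k t.

(** On [0, 1[ this is the map from binary expansions to the Cantor set of ratio
rho. The partial sums are nondecreasing in n, so the supremum is their limit. *)
Definition cantor_map t : R := sup (range (cantor_partial ^~ t)).

Lemma cantor_digit01 k t : 0 <= cantor_digit k t <= 1.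
Proof.
rewrite /cantor_digit ler0z lerz1.
have := dyadicS k t; lia.
Qed.

Lemma cantor_partialS n t : cantor_partial n.+1 t =
  cantor_partial n t + (1 - rho) * rho ^+ n * cantor_digit n t.
Proof. by rewrite /cantor_partial big_ord_recr /= addrA. Qed.

(** The digits beyond n contribute at most the geometric tail
(1 - rho) * (rho ^ n + rho ^ (n + 1) + ...), which is rho ^ n. *)
Lemma cantor_partialD n m t : cantor_partial n t <= cantor_partial (n + m) t <=
  cantor_partial n t + rho ^+ n - rho ^+ (n + m).
Proof.
elim: m => [|m /andP[IH1 IH2]]; first by rewrite addn0; lra.
rewrite addnS cantor_partialS exprS.
have /andP[d0 d1] := cantor_digit01 (n + m) t.
have q0 : 0 <= (1 - rho) * rho ^+ (n + m).
  by apply: mulr_ge0; [move: rho_bound; lra|rewrite ltW].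
have := mulr_ge0 q0 d0.
have : 0 <= (1 - rho) * rho ^+ (n + m) * (1 - cantor_digit (n + m) t).
  by apply: mulr_ge0 => //; lra.
by move: IH1 IH2; rewrite !mulrBr !mulrBl !mul1r mulr1; lra.
Qed.

Lemma cantor_map_bounds n t :
  cantor_partial n t <= cantor_map t <= cantor_partial n t + rho ^+ n.
Proof.
have ub : ubound (range (cantor_partial ^~ t)) (cantor_partial n t + rho ^+ n).
  move=> _ [m _ <-]; have [nm|/ltnW mn] := leqP n m.
    have := cantor_partialD n (m - n) t; rewrite subnKC//.
    by have := rhoX_gt0 m; lra.
  have := cantor_partialD m (n - m) t; rewrite subnKC//.
  by have := rhoX_gt0 n; lra.
apply/andP; split; last by apply: ge_sup => //; exists (cantor_partial n t), n.
by apply: ub_le_sup; [exists (cantor_partial n t + rho ^+ n)|exists n].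
Qed.

Lemma eq_cantor_partial n t t' : t <= t' -> dyadic n t = dyadic n t' ->
  cantor_partial n t = cantor_partial n t'.
Proof.
move=> le E; rewrite /cantor_partial (dyadic_eq_lower (leq0n n) le E).
congr (_ + _); apply: eq_bigr => k _; rewrite /cantor_digit.
rewrite (dyadic_eq_lower (ltn_ord k) le E).
by rewrite (dyadic_eq_lower (ltnW (ltn_ord k)) le E).
Qed.

Lemma cantor_map_oscillation n t t' : t <= t' -> dyadic n t = dyadic n t' ->
  cantor_map t' <= cantor_map t + rho ^+ n.
Proof.
move=> le E; have := cantor_map_bounds n t; have := cantor_map_bounds n t'.
rewrite (eq_cantor_partial le E); lra.
Qed.

(** If t and t' first differ at digit n, that digit separates their images by
(1 - rho) * rho ^ n, and the later digits can close at most rho ^ (n + 1) of this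
distance. This is where rho < 1 / 2 matters. *)
Lemma cantor_map_gap n t t' : t <= t' -> dyadic n t = dyadic n t' ->
  dyadic n.+1 t != dyadic n.+1 t' ->
  (1 - 2 * rho) * rho ^+ n <= cantor_map t' - cantor_map t.
Proof.
move=> le E N; have := cantor_map_bounds n.+1 t; have := cantor_map_bounds n.+1 t'.
rewrite !cantor_partialS (eq_cantor_partial le E) exprS.
have : cantor_digit n t + 1 <= cantor_digit n t'.
  rewrite /cantor_digit E -[X in _ + X]/(1%:~R) -intrD ler_int.
  by have := dyadic_le n.+1 le; move: N; lia.
have q0 : 0 <= (1 - rho) * rho ^+ n.
  by apply: mulr_ge0; [move: rho_bound; lra|rewrite ltW].
by move=> /(ler_wpM2l q0); lra.
Qed.

Lemma cantor_map_nondecreasing : {homo cantor_map : t t' / t <= t'}.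
Proof.
move=> t t'; rewrite le_eqVlt => /predU1P[->//|lt].
have [n nP min] := ex_minnP (dyadic_separates lt).
case: n nP min => [|n] N min.
  have := cantor_map_bounds 0 t; have := cantor_map_bounds 0 t'.
  rewrite /cantor_partial !big_ord0 !addr0 expr0.
  have : (dyadic 0 t)%:~R + 1 <= (dyadic 0 t')%:~R :> R.
    rewrite -[X in _ + X]/(1%:~R) -intrD ler_int.
    by have := dyadic_le 0 (ltW lt); move: N; lia.
  lra.
have E : dyadic n t = dyadic n t'.
  by apply/eqP/negP => /negP /min; rewrite ltnn.
have := cantor_map_gap (ltW lt) E N.
have : 0 <= (1 - 2 * rho) * rho ^+ n.
  by apply: mulr_ge0; [move: rho_bound; lra|rewrite ltW].
lra.
Qed.

Lemma cantor_map_itv t : 0 <= t < 1 -> 0 <= cantor_map t <= 1.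
Proof.
move=> t01; have := cantor_map_bounds 0 t.
rewrite /cantor_partial big_ord0 addr0 expr0 (@dyadic_eqP _ 0 t 0) ?add0r//.
by rewrite expr0 mul1r.
Qed.

(** The dyadic intervals are closed on the left, so the first digits do not change
just to the right of t; they do change to the left of a dyadic number, where the
map jumps. *)
Lemma cantor_map_right_continuous t e : 0 < e ->
  exists2 d, 0 < d & forall t', t <= t' < t + d -> cantor_map t' <= cantor_map t + e.
Proof.
move=> e0; have [|n hn] := @exists_expr_le R rho e _ e0; first by move: rho_bound; lra.
have := dyadicP n t => /andP[h1 h2].
have p0 : 0 < 2 ^+ n :> R by rewrite exprn_gt0.
exists (((dyadic n t)%:~R + 1) / 2 ^+ n - t).
  by rewrite subr_gt0 ltr_pdivlMr// mulrC.
move=> t' /andP[tt']; rewrite addrC subrK ltr_pdivlMr// mulrC => lt.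
apply: (le_trans (cantor_map_oscillation (n := n) tt' _)); last by rewrite lerD2l.
apply/esym/dyadic_eqP; rewrite lt andbT; apply: (le_trans h1).
by rewrite ler_pM2l.
Qed.

(** Points that first differ at digit n are at distance at most 2 ^ (- n), which is
(rho ^ n) ^ theta, while their images are at distance at least
(1 - 2 * rho) * rho ^ n. *)
Lemma cantor_map_inverse_holder theta t t' : 0 <= theta ->
  rho `^ theta = 2^-1 -> 0 <= t < 1 -> 0 <= t' < 1 ->
  `|t - t'| <= (`|cantor_map t - cantor_map t'| / (1 - 2 * rho)) `^ theta.
Proof.
move=> th0 rth; wlog : t t' / t <= t'.
  move=> H h h'; have [le|/ltW le] := leP t t'; first exact: H.
  by rewrite distrC (distrC (cantor_map t)); exact: H.
rewrite le_eqVlt => /predU1P[->|lt] h h'; first by rewrite !subrr normr0 powR_ge0.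
have [n nP min] := ex_minnP (dyadic_separates lt).
case: n nP min => [|n] N min.
  by move: N; rewrite !(@dyadic_eqP _ 0 _ 0)// expr0 mul1r add0r.
have E : dyadic n t = dyadic n t'.
  by apply/eqP/negP => /negP /min; rewrite ltnn.
have gap := cantor_map_gap (ltW lt) E N.
have r0 : 0 < 1 - 2 * rho by move: rho_bound; lra.
rewrite distrC ger0_norm ?subr_ge0 ?(ltW lt)// distrC.
rewrite (ger0_norm (x := _ - cantor_map t)); last first.
  by rewrite subr_ge0; exact/cantor_map_nondecreasing/ltW.
apply: (le_trans (dyadic_dist (ltW lt) E)).
rewrite -rth -powR_mulrn ?powR_ge0// powRAC powR_mulrn ?(ltW rho_gt0)//.
have le : rho ^+ n <= (cantor_map t' - cantor_map t) / (1 - 2 * rho).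
  by rewrite ler_pdivlMr// mulrC.
have p0 : 0 <= rho ^+ n by exact: ltW.
by apply: ge0_ler_powR => //; rewrite nnegrE// (le_trans p0).
Qed.

End cantor_map.

(** * Rotations of the circle *)

(** The product sigma-algebra contains the Borel sets of the plane, since every
open set is a union of countably many squares with rational centre and radius. *)
Lemma open_measurable_plane (R : realType) (V : set (R * R)) :
  open V -> measurable (V : set (measurableTypeR R * measurableTypeR R)).
Proof.
move=> oV.
pose box (q : rat * rat * rat) : set (R * R) :=
  ball (ratr q.1.1 : R) (ratr q.2 : R) `*` ball (ratr q.1.2 : R) (ratr q.2 : R).
have -> : V = \bigcup_q (if `[< box q `<=` V >] then box q else set0).
  apply/seteqP; split=> [[x y] Vxy|p [q _]]; last by case: asboolP => // h /h.
  have /nbhs_ballP[e /= e0 he] : nbhs (x, y) V by exact: open_nbhs_nbhs.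
  have [r] : exists r : rat, 0 < (ratr r : R) < e / 2.
    have [|r] := @rat_in_itvoo R 0 (e / 2); first by rewrite divr_gt0.
    by rewrite in_itv/= => h; exists r.
  move=> /andP[r0 re].
  have close (z : R) : exists q : rat, `|ratr q - z| < ratr r :> R.
    have [|q] := @rat_in_itvoo R (z - ratr r) (z + ratr r); first lra.
    by rewrite in_itv/= => h; exists q; rewrite ltr_norml; lra.
  have [[q1 h1] [q2 h2]] := (close x, close y).
  exists (q1, q2, r) => //; case: asboolP => [_|[]]; first by split.
  move=> [x' y'] [] /=; rewrite /ball/= => h3 h4; apply: he; split => /=.
    rewrite /ball/=; move: h1 h3; rewrite !ltr_norml; lra.
  rewrite /ball/=; move: h2 h4; rewrite !ltr_norml; lra.
apply: countable_bigcupT_measurable => [|q]; first exact: countableP.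
case: ifP => // _; by apply: measurableX; rewrite ball_itv; exact: measurable_itv.
Qed.

(** For intersections of intervals of various kinds, this avoids finding out which
endpoints are included. *)
Lemma lebesgue_measure_between (R : realType) (A : set R) (a b : R) :
  measurable A -> a <= b -> `]a, b[%classic `<=` A -> A `<=` `[a, b]%classic ->
  lebesgue_measure A = (b - a)%:E.
Proof.
move=> mA; rewrite le_eqVlt => /predU1P[->|ab] h1 h2.
  apply/eqP; rewrite subrr eq_le measure_ge0 andbT.
  rewrite (_ : 0%:E = lebesgue_measure (`[b, b]%classic : set R)).
    by apply: le_measure; rewrite ?inE//; exact: measurable_itv.
  by rewrite set_itv1 lebesgue_measure_set1.
apply/eqP; rewrite eq_le; apply/andP; split.
  rewrite (_ : (b - a)%:E = lebesgue_measure (`[a, b]%classic : set R)).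
    by apply: le_measure; rewrite ?inE//; exact: measurable_itv.
  by rewrite lebesgue_measure_itv/= lte_fin ab EFinB.
rewrite (_ : (b - a)%:E = lebesgue_measure (`]a, b[%classic : set R)).
  by apply: le_measure; rewrite ?inE//; exact: measurable_itv.
by rewrite lebesgue_measure_itv/= lte_fin ab EFinB.
Qed.

Section rotation.
Variable R : realType.
Implicit Types x z : R.

(** The sum modulo 1 of two numbers whose sum lies in [0, 2[. *)
Definition add_mod1 x z : R := if x + z < 1 then x + z else x + z - 1.

Lemma add_mod1_itv x z : 0 <= x < 1 -> 0 <= z <= 1 -> 0 <= add_mod1 x z <= 1.
Proof. by move=> hx hz; rewrite /add_mod1; case: ltP; lra. Qed.

(** The points that wrap around the circle and those that do not are translated
into the arc by z - 1 and z respectively, and their lengths add up. *)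
Lemma lebesgue_measure_rotation z v1 v2 : 0 <= z <= 1 ->
  0 <= v1 -> v1 <= v2 -> v2 <= 1 ->
  lebesgue_measure [set x : R | 0 <= x < 1 /\ v1 <= add_mod1 x z <= v2] =
  (v2 - v1)%:E.
Proof.
move=> hz v10 v12 v21.
pose A1 : set R := `[0, 1 - z[%classic `&` `[v1 - z, v2 - z]%classic.
pose A2 : set R :=
  `[1 - z, 1[%classic `&` `[v1 - z + 1, v2 - z + 1]%classic.
have mA1 : measurable A1 by apply: measurableI; exact: measurable_itv.
have mA2 : measurable A2 by apply: measurableI; exact: measurable_itv.
set A := (X in lebesgue_measure X); have -> : (A : set R) = A1 `|` A2.
  rewrite /A /A1 /A2 /add_mod1; apply/seteqP; split=> x /=.
    by case: (ltP (x + z) 1) => h1 [h2 h3]; [left|right];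
      rewrite !in_itv/=; split; lra.
  by case=> -[]; rewrite !in_itv/= => h1 h2; case: (ltP (x + z) 1) => h3; split; lra.
have lengths a1 b1 a2 b2 : a1 <= b1 -> a2 <= b2 -> b1 - a1 + (b2 - a2) = v2 - v1 ->
    `]a1, b1[%classic `<=` A1 -> A1 `<=` `[a1, b1]%classic ->
    `]a2, b2[%classic `<=` A2 -> A2 `<=` `[a2, b2]%classic ->
    lebesgue_measure (A1 `|` A2) = (v2 - v1)%:E.
  move=> h1 h2 h3 h4 h5 h6 h7.
  transitivity (lebesgue_measure (A1 : set R) + lebesgue_measure (A2 : set R))%E.
    apply: measureU => //; rewrite -subset0 => x.
    by rewrite /A1 /A2 /= !in_itv/= => -[[? ?] [? ?]]; lra.
  rewrite (lebesgue_measure_between mA1 h1 h4 h5).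
  by rewrite (lebesgue_measure_between mA2 h2 h6 h7) -EFinD h3.
have sub1 a b : a <= b -> 0 <= a -> v1 - z <= a -> b <= v2 - z -> b <= 1 - z ->
    `]a, b[%classic `<=` A1.
  by move=> *; move=> x; rewrite /A1/= !in_itv/= => /andP[? ?]; split; lra.
have sub2 a b : a <= b -> 1 - z <= a -> v1 - z + 1 <= a -> b <= v2 - z + 1 -> b <= 1 ->
    `]a, b[%classic `<=` A2.
  by move=> *; move=> x; rewrite /A2/= !in_itv/= => /andP[? ?]; split; lra.
(* z up to v1: the preimage of the arc does not wrap; z up to v2: it is cut in
   two; z beyond v2: all of it wraps *)
have [h1|h1] := leP z v1; last have [h2|h2] := leP z v2.
- apply: (lengths (v1 - z) (v2 - z) 1 1); try lra.
  + by apply: sub1; lra.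
  + by move=> x; rewrite /A1/= !in_itv/= => -[].
  + by move=> x; rewrite /= in_itv/=; lra.
  + by move=> x; rewrite /A2/= !in_itv/= => -[? ?]; lra.
- apply: (lengths 0 (v2 - z) (v1 - z + 1) 1); try lra.
  + by apply: sub1; lra.
  + by move=> x; rewrite /A1/= !in_itv/= => -[? ?]; lra.
  + by apply: sub2; lra.
  + by move=> x; rewrite /A2/= !in_itv/= => -[? ?]; lra.
- apply: (lengths 0 0 (v1 - z + 1) (v2 - z + 1)); try lra.
  + by move=> x; rewrite /= in_itv/=; lra.
  + by move=> x; rewrite /A1/= !in_itv/= => -[? ?]; lra.
  + by apply: sub2; lra.
  + by move=> x; rewrite /A2/= !in_itv/= => -[].
Qed.

End rotation.

(** * A point of the square displaced by a random amount *)

Section retraction.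
Variable R : realType.

Definition clip (x : R) : R := Num.max 0 (Num.min x 1).

Lemma clip_itv x : 0 <= clip x <= 1.
Proof. by rewrite /clip le_max lexx ge_max ge_min ler01 lexx orbT. Qed.

Lemma clip_id x : 0 <= x <= 1 -> clip x = x.
Proof. by move=> /andP[x0 x1]; rewrite /clip min_l// max_r. Qed.

Lemma clip_unit_square (q : R * R) : (clip q.1, clip q.2) \in @unit_square R.
Proof. by rewrite inE; split; rewrite /= in_itv /= clip_itv. Qed.

(** A retraction of the plane onto the square: it makes planar maps that are
only relevant on part of their domain into total maps to the square. *)
Definition to_square (q : R * R) : square R :=
  exist (fun p => p \in @unit_square R) _ (clip_unit_square q).

Lemma to_squareK (q : R * R) : unit_square q -> square_val (to_square q) = q.
Proof.
case: q => x y [] /=; rewrite !in_itv /= => h1 h2.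
by change ((clip x, clip y) = (x, y)); rewrite !clip_id.
Qed.

End retraction.

Section graph_measure.
Variables (R : realType) (c : R -> R).
Hypothesis c_nd : {homo c : t t' / t <= t'}.
Hypothesis c_itv : forall t : R, 0 <= t < 1 -> 0 <= c t <= 1.
Hypothesis c_rc : forall t e : R, 0 < e ->
  exists2 d : R, 0 < d & forall t', t <= t' < t + d -> c t' <= c t + e.

Local Notation T := (measurableTypeR R).
Local Notation area := (@lebesgue_measure R \x @lebesgue_measure R)%E.

(** A random parameter (w, x), uniform in [0, 1[ ^ 2, gives the point whose
first coordinate x is independent of its displacement c w. *)
Definition displace (p : T * T) : R * R := (p.2, add_mod1 p.2 (c p.1)).

Definition parameters : set (T * T) := `[0, 1[%classic `*` `[0, 1[%classic.

Lemma parametersP (p : T * T) :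
  parameters p <-> (0 <= (p.1 : R) < 1) /\ (0 <= (p.2 : R) < 1).
Proof. by rewrite /parameters /= !in_itv. Qed.

Lemma measurable_parameters : measurable parameters.
Proof. by apply: measurableX; exact: measurable_itv. Qed.

Lemma displace_unit_square p : parameters p -> unit_square (displace p).
Proof.
move=> /parametersP[h1 h2]; split; rewrite /= in_itv /=.
  by move/andP: h2 => [-> /ltW].
by apply: add_mod1_itv => //; exact: c_itv.
Qed.

Lemma measurable_clip : measurable_fun [set: T] (@clip R : T -> T).
Proof.
apply: nondecreasing_measurable => // x y xy.
by rewrite /clip ge_max !le_max lexx/= le_min !ge_min xy lexx !orbT.
Qed.

Lemma measurable_displace2 :
  measurable_fun [set: T * T] (fun p : T * T => (displace p).2 : T).
Proof.
have mc : measurable_fun [set: T * T] (fun p : T * T => c p.1 : T).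
  by apply: (measurableT_comp _ measurable_fst); exact: nondecreasing_measurable.
have ms : measurable_fun [set: T * T] (fun p : T * T => ((p.2 : R) + c p.1) : T).
  by apply: measurable_funD.
apply: measurable_fun_ifT => //.
- exact: measurable_fun_ltr.
- exact: measurable_funB.
Qed.

Lemma measurable_to_square_displace :
  measurable_fun [set: T * T] (@to_square R \o displace : T * T -> borel_square R).
Proof.
apply: (@measurability _ _ _ (borel_square R) _ _ (@open (square R))) => //.
move=> _ [_ [V oV <-] <-].
rewrite setTI.
pose h (p : T * T) : T * T := (clip p.2, clip (displace p).2).
rewrite (_ : _ @^-1` _ = h @^-1` (V : set (T * T)))//.
rewrite -[X in measurable X]setTI.
apply: (_ : measurable_fun setT h) => //; last exact: open_measurable_plane.
apply: measurable_fun_pair; apply: (measurableT_comp measurable_clip) => //.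
exact: measurable_displace2.
Qed.

Definition graph_measure : set (borel_square R) -> \bar R :=
  pushforward (mrestr area measurable_parameters)
    (@to_square R \o displace : T * T -> borel_square R).

Let graph_measure0 : graph_measure set0 = 0%E.
Proof. by apply: measure0; exact: measurable_to_square_displace. Qed.

Let graph_measure_ge0 A : (0 <= graph_measure A)%E.
Proof. by apply: measure_ge0; exact: measurable_to_square_displace. Qed.

Let graph_measure_sigma_additive : semi_sigma_additive graph_measure.
Proof.
by apply: measure_semi_sigma_additive; exact: measurable_to_square_displace.
Qed.

HB.instance Definition _ := isMeasure.Build _ _ _ graph_measure
  graph_measure0 graph_measure_ge0 graph_measure_sigma_additive.

(** That [graph_measure] is a measure depends on the monotonicity of c; bundling the
two lets later statements name that proof only once. *)
Definition graph_mu : {measure set (borel_square R) -> \bar R} := graph_measure.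

Lemma graph_muE A : graph_mu A =
  area ([set p | A (to_square (displace p))] `&` parameters).
Proof. by []. Qed.

Lemma rectangle_displace p (u1 u2 v1 v2 : R) : parameters p ->
  rectangle u1 u2 v1 v2 (to_square (displace p)) <->
  u1 <= p.2 <= u2 /\ v1 <= add_mod1 p.2 (c p.1) <= v2.
Proof.
move=> pp; change ((`[u1, u2]%classic `*` `[v1, v2]%classic)
  (square_val (to_square (displace p))) <->
  u1 <= p.2 <= u2 /\ v1 <= add_mod1 p.2 (c p.1) <= v2).
by rewrite to_squareK /= ?in_itv//; exact: displace_unit_square.
Qed.

Lemma area_setX (A B : set R) : measurable A -> measurable B ->
  area (A `*` B) = (lebesgue_measure A * lebesgue_measure B)%E.
Proof. by move=> mA mB; exact: product_measure1E. Qed.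

Lemma unit_itv_measure (a b : R) : 0 <= a -> a <= b -> b <= 1 ->
  lebesgue_measure (`[0, 1[%classic `&` `[a, b]%classic : set R) = (b - a)%:E.
Proof.
move=> a0 ab b1; apply: lebesgue_measure_between => //.
- by apply: measurableI; exact: measurable_itv.
- by move=> x /=; rewrite !in_itv/= => ?; split; lra.
Qed.

Lemma graph_mu_marginal1 (a b : R) : 0 <= a -> a <= b -> b <= 1 ->
  graph_mu (rectangle a b 0 1) = (b - a)%:E.
Proof.
move=> a0 ab b1; rewrite graph_muE.
rewrite (_ : _ `&` _ = `[0, 1[%classic `*` (`[0, 1[%classic `&` `[a, b]%classic)).
  rewrite area_setX; last 2 first.
  - exact: measurable_itv.
  - by apply: measurableI; exact: measurable_itv.
  rewrite unit_itv_measure// lebesgue_measure_itv/= lte_fin ltr01.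
  by rewrite sube0 mul1e.
apply/seteqP; split=> -[w x].
  move=> [/= h pwx]; have /(rectangle_displace _ _ _ _)/= := pwx => E.
  by move: h; rewrite E => -[h3 _]; case: pwx => h1 h2; split.
move=> [/= h1 [h2 h3]]; have pwx : parameters (w, x) by [].
split => //=; apply/rectangle_displace => //=.
by have [_] := displace_unit_square pwx; rewrite /= !in_itv/= in h3 *.
Qed.

(** The section of the strip at w is the preimage of an arc under the rotation by
c w. It has the same length as the arc for every w, so the strip has the same area
as a rectangle of height b - a. *)
Lemma graph_mu_marginal2 (a b : R) : 0 <= a -> a <= b -> b <= 1 ->
  graph_mu (rectangle 0 1 a b) = (b - a)%:E.
Proof.
move=> a0 ab b1; rewrite graph_muE; set B := (X in area X).
have sectionB w : lebesgue_measure (xsection B w) =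
    lebesgue_measure (xsection (`[0, 1[%classic `*`
      (`[0, 1[%classic `&` `[a, b]%classic) : set (T * T)) w).
  have [w01|w01] := boolP (w \in (`[0, 1[%classic : set T)); last first.
    rewrite notin_xsectionX//; congr lebesgue_measure; rewrite -subset0 => x.
    by rewrite /xsection/= inE => -[_ [/= h _]]; move: w01; rewrite notin_setE.
  rewrite in_xsectionX// unit_itv_measure//.
  have w01' : 0 <= (w : R) < 1 by move: w01; rewrite inE /= in_itv.
  rewrite -(lebesgue_measure_rotation (c_itv w01') a0 ab b1); congr lebesgue_measure.
  apply/seteqP; split=> x; rewrite /xsection /= inE /B /=.
    move=> [/rectangle_displace h pwx]; have [/= _ h'] := h pwx; split => //.
    by move/parametersP : pwx => [].
  move=> [h1 h2]; have pwx : parameters (w, x) by exact/parametersP.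
  by split=> //; apply/rectangle_displace => //; split=> //=; move/andP: h1 => [-> /ltW].
transitivity (area (`[0, 1[%classic `*` (`[0, 1[%classic `&` `[a, b]%classic))).
  by apply: eq_integral => w _; exact: sectionB.
rewrite area_setX; last 2 first.
- exact: measurable_itv.
- by apply: measurableI; exact: measurable_itv.
rewrite unit_itv_measure// lebesgue_measure_itv/= lte_fin ltr01.
by rewrite sube0 mul1e.
Qed.

(** Moving both parameters slightly to the right moves the point only slightly,
also across the cut of the circle and at the jumps of c. *)
Lemma displace_support p : parameters p ->
  measure_support graph_mu (to_square (displace p)).
Proof.
case: p => w x pwx [U [oU U0] Up]; case: oU => V oV VU.
have /parametersP[/= hw hx] := pwx.
have Vp : V (displace (w, x)).
  by rewrite -(to_squareK (displace_unit_square pwx)); rewrite -VU in Up.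
have /nbhs_ballP[e /= e0 he] : nbhs (displace (w, x)) V by exact: open_nbhs_nbhs.
(* room left before x + c w reaches 1; past the cut there is no constraint *)
pose gap := if x + c w < 1 then 1 - (x + c w) else 1.
have gap0 : 0 < gap by rewrite /gap; case: (ltP (x + c w) 1); lra.
pose e' := Num.min e gap / 2.
have e'0 : 0 < e' by rewrite divr_gt0// lt_min e0.
have e'e : e' <= e / 2 by rewrite /e' ler_pM2r// ge_min lexx.
have e'g : e' <= gap / 2 by rewrite /e' ler_pM2r// ge_min lexx orbT.
have [d d0 hd] := c_rc w e'0.
pose dw := Num.min d (1 - w); pose dx := Num.min e' (1 - x).
have dw0 : 0 < dw by rewrite lt_min d0 subr_gt0; lra.
have dx0 : 0 < dx by rewrite lt_min e'0 subr_gt0; lra.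
have dwd : dw <= d by rewrite ge_min lexx.
have dw1 : dw <= 1 - w by rewrite ge_min lexx orbT.
have dxe : dx <= e' by rewrite ge_min lexx.
have dx1 : dx <= 1 - x by rewrite ge_min lexx orbT.
pose N : set (T * T) := `[w, w + dw[%classic `*` `[x, x + dx[%classic.
have NU : N `<=` [set p | U (to_square (displace p))] `&` parameters.
  move=> [w' x'] [/=]; rewrite !in_itv/= => hw' hx'.
  have pwx' : parameters (w', x') by apply/parametersP => /=; split; lra.
  split => //=; rewrite -VU; change (V (square_val (to_square (displace (w', x'))))).
  rewrite to_squareK; last exact: displace_unit_square.
  apply: he; split; rewrite /ball/=; first by rewrite ltr_norml; lra.
  have cw : c w' <= c w + e' by apply: hd; lra.
  have cw' : c w <= c w' by apply: c_nd; lra.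
  move: gap0 e'g; rewrite /gap /add_mod1.
  by case: (ltP (x + c w) 1) => h1 h2 h3; case: (ltP (x' + c w') 1) => h4;
    rewrite ltr_norml; lra.
suff : (0 < graph_mu U)%E by rewrite U0 ltxx.
have mN : measurable N by apply: measurableX; exact: measurable_itv.
apply: (@lt_le_trans _ _ (area N)).
  rewrite area_setX; do ?exact: measurable_itv.
  rewrite !lebesgue_measure_itv/= !lte_fin !ltrDl dw0 dx0 -!EFinD -EFinM lte_fin.
  by rewrite mulr_gt0//; lra.
rewrite graph_muE; apply: le_measure; rewrite ?inE//.
apply: measurableI; last exact: measurable_parameters.
rewrite -[X in measurable X]setTI; apply: measurable_to_square_displace => //.
by apply: sub_sigma_algebra; exists V.
Qed.

(** The complement of K is a null open set. *)
Lemma support_sub_closed (K : set (R * R)) : closed K ->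
  (forall p, parameters p -> K (displace p)) ->
  @square_val R @` measure_support graph_mu `<=` K.
Proof.
move=> cK PK _ [q hq <-]; apply/not_notP => nK; apply: hq.
exists (@square_val R @^-1` (~` K)) => //; split.
  by exists (~` K) => //; rewrite openC.
rewrite graph_muE (_ : _ `&` _ = set0) ?measure0// -subset0 => p [/= h pp].
by apply: h; rewrite to_squareK; [exact: PK|exact: displace_unit_square].
Qed.

End graph_measure.

(** * The measure of dimension s *)

Section fractal.
Variables (R : realType) (s rho : R).
Hypothesis s_gt1 : 1 < s.
Hypothesis rho_bound : 0 < rho < 2^-1.
Hypothesis rho_exponent : rho `^ (s - 1) = 2^-1.

Local Notation T := (measurableTypeR R).
Local Notation area := (@lebesgue_measure R \x @lebesgue_measure R)%E.
Local Notation c := (cantor_map rho).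

Let rho_gt0 : 0 < rho. Proof. by case/andP: rho_bound. Qed.

Let rhoX_gt0 n : 0 < rho ^+ n. Proof. by rewrite exprn_gt0. Qed.

Definition fractal_mu : {measure set (borel_square R) -> \bar R} :=
  graph_mu (cantor_map_nondecreasing rho_bound).

Definition fractal_set : set (R * R) :=
  @square_val R @` measure_support fractal_mu.

Lemma displace_fractal_set p : parameters p -> fractal_set (displace c p).
Proof.
move=> pp; have ci := @cantor_map_itv R rho rho_bound.
exists (to_square (displace c p)); last first.
  by rewrite to_squareK//; exact: displace_unit_square.
by apply: displace_support => //; exact: cantor_map_right_continuous.
Qed.

Definition mass_const : R := 8 * (4 / (1 - 2 * rho)) `^ (s - 1).

(** Half the length of an interval that contains every w whose image under c lies in
a given interval of length 4 * r. *)
Let halfwidth (r : R) : R := (4 * r / (1 - 2 * rho)) `^ (s - 1).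

Lemma cantor_map_preimage (b r : R) : 0 <= r -> exists w0 : R,
  forall w, 0 <= w < 1 -> `|c w - b| <= 2 * r ->
    w0 - halfwidth r <= w <= w0 + halfwidth r.
Proof.
move=> r0; have [[w0 [h0 d0]]|none] := pselect (exists w0 : R,
    0 <= w0 < 1 /\ `|c w0 - b| <= 2 * r); last first.
  by exists 0 => w hw dw; exfalso; apply: none; exists w.
exists w0 => w hw dw.
suff : `|w - w0| <= halfwidth r by rewrite ler_norml; lra.
have s1 : 0 <= s - 1 by rewrite subr_ge0 ltW.
have k0 : 0 < 1 - 2 * rho by move: rho_bound; lra.
apply: (le_trans (cantor_map_inverse_holder rho_bound s1 rho_exponent hw h0)).
have le : `|c w - c w0| <= 4 * r.
  by have := ler_distD b (c w) (c w0); rewrite (distrC b); lra.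
apply: ge0_ler_powR => //; rewrite ?nnegrE ?divr_ge0 ?mulr_ge0 ?(ltW k0)//.
by rewrite ler_pM2r ?invr_gt0.
Qed.

(** The set G is a union of two rectangles that contains the parameters of all points
of U: one interval for x and, as y may or may not have wrapped around the circle,
two intervals for w. Using G in place of the preimage of U avoids asking that U be
measurable. *)
Lemma mass_of_small_set (U : set (R * R)) : (diam U <= 1%:E)%E ->
  exists G : set (T * T), [/\ measurable G,
    forall p, parameters p -> U (displace c p) -> G p &
    (area G <= mass_const%:E * diam_pow s U)%E].
Proof.
move=> dU; have [->|/set0P[[a b] Uab]] := eqVneq U set0.
  by exists set0; split => //; rewrite measure0 diam_pow_set0 mule0.
have [d dE /andP[d0 d1]] := diam_finP dU.
have [w0 h0] := cantor_map_preimage (b - a) d0.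
have [w1 h1] := cantor_map_preimage (b - a + 1) d0.
set L := halfwidth d in h0 h1.
pose I0 : set R := `[w0 - L, w0 + L]%classic.
pose I1 : set R := `[w1 - L, w1 + L]%classic.
pose J : set R := `[a - d, a + d]%classic.
have mU : measurable (I0 `|` I1) by apply: measurableU; exact: measurable_itv.
have mJ : measurable J by exact: measurable_itv.
have L0 : 0 <= L by exact: powR_ge0.
exists ((I0 `|` I1) `*` J); split.
- exact: measurableX.
- move=> [w x] /parametersP[/= hw hx] Up.
  have : eucl_dist (displace c (w, x)) (a, b) <= d.
    by rewrite -lee_fin -dE; exact: eucl_dist_le_diam.
  have [/= e1 e2] := coord_le_eucl_dist (displace c (w, x)) (a, b).
  move=> ed; move: (le_trans e1 ed) (le_trans e2 ed).
  rewrite /add_mod1 !ler_norml => {}e1 {}e2; split; last first.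
    by rewrite /J /= in_itv/=; lra.
  move: e2; case: (ltP (x + c w) 1) => _ e2; [left|right].
    by rewrite /I0 /= in_itv/=; apply: h0 => //; rewrite ler_norml; lra.
  by rewrite /I1 /= in_itv/=; apply: h1 => //; rewrite ler_norml; lra.
have len (u v : R) : u <= v -> lebesgue_measure (`[u, v]%classic : set R) = (v - u)%:E.
  move=> uv; apply: lebesgue_measure_between => // x.
  by rewrite /= !in_itv/= => /andP[/ltW-> /ltW->].
rewrite area_setX// /diam_pow; case: eqP => [U0|_]; first by rewrite U0 in Uab.
rewrite dE /= -EFinM.
have mI : (lebesgue_measure (I0 `|` I1) <= (4 * L)%:E)%E.
  apply: (@le_trans _ _ (lebesgue_measure I0 + lebesgue_measure I1)%E).
    by apply: measureU2; exact: measurable_itv.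
  by rewrite !len ?lee_fin; lra.
apply: (@le_trans _ _ ((4 * L)%:E * (2 * d)%:E)%E).
  by apply: lee_pmul => //; rewrite len ?lee_fin; lra.
rewrite -EFinM lee_fin /mass_const /L /halfwidth.
have k0 : 0 < 1 - 2 * rho by move: rho_bound; lra.
rewrite [4 * d / _]mulrAC powRM//; last by rewrite divr_ge0// ltW.
have -> : d `^ s = d * d `^ (s - 1).
  by rewrite mulr_powRB1// (lt_trans ltr01).
set A := _ `^ _; set B := d `^ _; rewrite le_eqVlt; apply/orP; left; apply/eqP; ring.
Qed.

(** The parameters are covered by the sets G of the members of the cover, and their
total area is 1. *)
Lemma fractal_mass_bound (U : nat -> set (R * R)) :
  fractal_set `<=` \bigcup_i U i -> (forall i, (diam (U i) <= 1%:E)%E) ->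
  (1%:E <= mass_const%:E * \sum_(0 <= i <oo) diam_pow s (U i))%E.
Proof.
move=> SU dU.
have [G GP] := choice (fun i => mass_of_small_set (dU i)).
have mG i : measurable (G i) by have [] := GP i.
have C0 : 0 <= mass_const by rewrite mulr_ge0// powR_ge0.
have -> : 1%:E = area (@parameters R).
  rewrite area_setX; do ?exact: measurable_itv.
  by rewrite !lebesgue_measure_itv/= !lte_fin !ltr01 !sube0 mule1.
apply: (@le_trans _ _ (\sum_(0 <= i <oo) area (G i))%E).
  apply: measure_sigma_subadditive => //; first exact: measurable_parameters.
  move=> p pp; have [i _ Ui] := SU _ (displace_fractal_set pp).
  by exists i => //; have [_ h _] := GP i; exact: h.
rewrite -nneseriesZl//; last by move=> *; exact: diam_pow_ge0.
by apply: lee_nneseries => // i _; have [] := GP i.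
Qed.

Section boxes.
Variable n : nat.

Let columns : nat := (Num.truncn (rho ^- n)).+1.

(** A box is given by the first n digits of w, a column for x, and whether x + c w
has wrapped around the circle. *)
Definition cover_index : finType := ('I_(2 ^ n) * 'I_columns * bool)%type.

(** Within a box x and c w each vary by rho ^ n, hence y varies by twice as much; the
boolean is subtracted as 0 or 1. *)
Definition cover_box (i : cover_index) : set (R * R) :=
  let x := i.1.2%:R * rho ^+ n in
  let y := x + c (i.1.1%:R / 2 ^+ n) - i.2%:R in
  `[x, x + rho ^+ n]%classic `*` `[y, y + 2 * rho ^+ n]%classic.

Lemma card_cover_index : #|cover_index|%:R <= 4 * (rho ^+ n) `^ (- s).
Proof.
have pn := rhoX_gt0 n; have x1 : rho ^+ n <= 1.
  by rewrite exprn_ile1 ?ltW//; move: rho_bound; lra.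
have y1 : 1 <= rho ^- n by rewrite invf_ge1.
have cols : columns%:R <= 2 * rho ^- n :> R.
  have := @truncn_itv R (rho ^- n); rewrite invr_ge0 ltW// => /(_ isT) /andP[h _].
  by rewrite /columns -natr1; lra.
have -> : (rho ^+ n) `^ (- s) = 2 ^+ n * rho ^- n.
  have e : (rho ^+ n) `^ (s - 1) = 2^-1 ^+ n.
    by rewrite -rho_exponent -[RHS]powR_mulrn ?powR_ge0// powRAC
      powR_mulrn ?(ltW rho_gt0).
  rewrite powRN -(mulr_powRB1 (ltW pn) (lt_trans ltr01 s_gt1)) e.
  by rewrite invfM exprVn invrK mulrC.
rewrite !card_prod !card_ord card_bool !natrM natrX.
have -> : 4 * (2 ^+ n * rho ^- n) = 2 ^+ n * (2 * rho ^- n) * 2 :> R.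
  by set z := rho ^- n; ring.
by rewrite ler_wpM2r// ler_wpM2l// exprn_ge0.
Qed.

Lemma diam_cover_box i : (diam (cover_box i) <= (3 * rho ^+ n)%:E)%E.
Proof.
have pn := rhoX_gt0 n; apply: diam_le; first by rewrite mulr_ge0// ltW.
move=> [x y] [x' y'] [/= + +] [/= + +]; rewrite !in_itv/= => h1 h2 h3 h4.
apply: (le_trans (eucl_dist_le_coord _ _)) => /=.
have e1 : `|x - x'| <= rho ^+ n by rewrite ler_norml; lra.
have e2 : `|y - y'| <= 2 * rho ^+ n by rewrite ler_norml; lra.
lra.
Qed.

Lemma fractal_set_cover : fractal_set `<=` \bigcup_i cover_box i.
Proof.
apply: support_sub_closed; first by apply: cantor_map_itv.
  by apply: closed_bigcup => [|i _]; [exact: finite_finset|exact: closed_box].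
move=> [w x] /parametersP[/= hw hx].
have pn := rhoX_gt0 n; have p2 : 0 < 2 ^+ n :> R by rewrite exprn_gt0.
have /andP[hw0 hw1] := hw; have /andP[hx0 hx1] := hx.
have /andP[k1 k2] := truncn_itv (mulr_ge0 (ltW p2) hw0).
have /andP[j1 j2] := truncn_itv (divr_ge0 hx0 (ltW pn)).
set k := Num.truncn _ in k1 k2; set j := Num.truncn _ in j1 j2.
have kn : (k < 2 ^ n)%N.
  rewrite -(ltr_nat R) natrX (le_lt_trans k1)// -[ltRHS]mulr1 ltr_pM2l//.
have jn : (j < columns)%N.
  rewrite -(ltr_nat R) (le_lt_trans j1)//.
  have := @truncn_itv R (rho ^- n); rewrite invr_ge0 ltW// => /(_ isT) /andP[_].
  by apply: le_lt_trans; rewrite -[leRHS]mul1r ler_pM2r ?invr_gt0// ltW.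
pose w' : R := k%:R / 2 ^+ n.
have w'w : w' <= w by rewrite ler_pdivrMr// mulrC.
have c1 : c w' <= c w by exact: cantor_map_nondecreasing.
have c2 : c w <= c w' + rho ^+ n.
  apply: (cantor_map_oscillation rho_bound w'w).
  rewrite (@dyadic_eqP _ n w' k); last by rewrite mulrC divfK ?gt_eqF//; lra.
  by rewrite (@dyadic_eqP _ n w k)// k1 natr1.
have x1 : j%:R * rho ^+ n <= x by rewrite -ler_pdivlMr.
have x2 : x <= j%:R * rho ^+ n + rho ^+ n.
  by rewrite -[X in _ + X]mul1r -mulrDl -ler_pdivrMr// natr1 ltW.
exists (Ordinal kn, Ordinal jn, 1 <= x + c w) => //.
rewrite /cover_box -/w'; split; rewrite /= in_itv/= -/w'; first lra.
by rewrite /add_mod1; case: (ltP (x + c w) 1) => h /=; lra.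
Qed.

End boxes.

Lemma geometric_scale (delta : R) : 0 < delta <= 1 ->
  exists n, 3 * rho ^+ n <= delta <= 3 / rho * rho ^+ n.
Proof.
move=> /andP[d0 d1].
have ex : exists n, 3 * rho ^+ n <= delta.
  have d3 : 0 < delta / 3 by rewrite divr_gt0.
  have [|n hn] := @exists_expr_le R rho _ _ d3; first by move: rho_bound; lra.
  by exists n; rewrite mulrC -ler_pdivlMr.
have [[|n] hn min] := ex_minnP ex; first by move: hn; rewrite expr0; lra.
exists n.+1; rewrite hn/= exprS mulrA divfK ?gt_eqF//.
by rewrite leNgt; apply/negP => /ltW/min; rewrite ltnn.
Qed.

Definition cover_const : R := 4 * (3 / rho) `^ s.

Lemma fractal_cover_bound (delta : R) : 0 < delta <= 1 ->
  exists (N : nat) (U : 'I_N -> set (R * R)),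
    [/\ fractal_set `<=` \bigcup_i U i, forall i, (diam (U i) <= delta%:E)%E &
        N%:R <= cover_const * delta `^ (- s)].
Proof.
move=> /[dup] /andP[d0 _] /geometric_scale[n /andP[n1 n2]].
exists #|cover_index n|, (fun i => cover_box (enum_val i)); split.
- move=> p /(fractal_set_cover n)[i _ pi].
  by exists (enum_rank i) => //; rewrite enum_rankK.
- by move=> i; apply: (le_trans (diam_cover_box _)); rewrite lee_fin.
apply: (le_trans (card_cover_index n)); rewrite /cover_const -mulrA ler_pM2l//.
have k0 : 0 < 3 / rho by rewrite divr_gt0.
have s0 : 0 <= s by rewrite ltW// (lt_trans ltr01).
rewrite !powRN ler_pdivlMr ?powR_gt0// mulrC ler_pdivrMr ?powR_gt0//.
rewrite -powRM; [|exact: ltW|exact: ltW].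
by apply: ge0_ler_powR => //; rewrite nnegrE;
  [exact: ltW|apply: mulr_ge0; exact: ltW].
Qed.

Lemma fractal_const_gt0 : 0 < mass_const /\ 0 < cover_const.
Proof.
have k0 : 0 < 1 - 2 * rho by move: rho_bound; lra.
by split; rewrite mulr_gt0// powR_gt0// divr_gt0.
Qed.

Lemma fractal_hausdorff_dim : hausdorff_dim fractal_set = s%:E.
Proof.
have [C0 K0] := fractal_const_gt0.
apply: (ahlfors_hausdorff_dim (lt_trans ltr01 s_gt1) C0 K0).
  exact: fractal_mass_bound.
exact: fractal_cover_bound.
Qed.

Lemma fractal_box_dim : has_box_dim fractal_set s.
Proof.
have [C0 K0] := fractal_const_gt0.
apply: (ahlfors_box_dim (lt_trans ltr01 s_gt1) C0 K0).
  exact: fractal_mass_bound.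
exact: fractal_cover_bound.
Qed.

End fractal.

Theorem theorem4 (R : realType) (s : R) (hs : 1 < s < 2) :
  exists Q : R -> R -> R,
    [/\ quasi_copula Q, induces_signed_measure Q &
        exists S : set (R * R),
          [/\ is_support Q S, hausdorff_dim S = s%:E & has_box_dim S s]].
Proof.
have /andP[s1 s2] := hs.
have t0 : 0 < s - 1 by rewrite subr_gt0.
(* the ratio for which the Cantor set has dimension s - 1 *)
pose rho : R := 2^-1 `^ (s - 1)^-1.
have rho_exponent : rho `^ (s - 1) = 2^-1.
  by rewrite /rho -powRrM mulVf ?gt_eqF// powRr1.
have rho_bound : 0 < rho < 2^-1.
  rewrite powR_gt0//= -ltr_ln ?posrE ?powR_gt0// ln_powR.
  have l0 : ln (2^-1 : R) < 0 by rewrite ln_lt0//; lra.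
  by rewrite gtr_nMl// invf_gt1//; lra.
have c_itv := @cantor_map_itv R rho rho_bound.
pose mu := fractal_mu rho_bound.
have m1 := graph_mu_marginal1 (cantor_map_nondecreasing rho_bound) c_itv.
have m2 := graph_mu_marginal2 (cantor_map_nondecreasing rho_bound) c_itv.
exists (copula_of_measure mu); split.
- exact: (copula_quasi_copula m1 m2).
- exact: (copula_induces_signed_measure m1 m2).
exists (fractal_set rho_bound); split.
- exact: (copula_is_support m1 m2).
- exact: fractal_hausdorff_dim.
- exact: fractal_box_dim.
Qed.
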